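(* Suppose that $(A,m,\sigma)$ is a braided algebra, that $(R,P,\sigma')$ is a commutative right weak braided Rota-Baxter algebra of weight $1$ with $R$ unital (unit $1_R$), and that $f:A\to R$ is an algebra map such that $(f\otimes f)\circ\sigma=\sigma'\circ(f\otimes f)$. Define a linear map $\overline{f}:T(A)\to R$ recursively by $\overline{f}(1)=1_R$, $\overline{f}(a_1)=P(f(a_1))$, and $$\overline{f}(a_1\otimes\cdots\otimes a_n)=P\big(f(a_1)\,\overline{f}(a_2\otimes\cdots\otimes a_n)\big)\qquad (n\ge2).$$ Then $\overline{f}$ is an algebra map from the quantum quasi-shuffle algebra $T^{qsh}_\sigma(A)=(T(A),\Join_\sigma)$ to $R$.
   Context: Everything is over a field $\mathbb{K}$ of characteristic $0$; algebras are associative, not necessarily unital unless stated (in particular $f$ is only required to be linear and multiplicative). A braiding on a vector space $V$ is an invertible linear map $\sigma\in\mathrm{End}(V\otimes V)$ with $(\sigma\otimes \mathrm{id})(\mathrm{id}\otimes \sigma)(\sigma\otimes \mathrm{id})=(\mathrm{id}\otimes \sigma)(\sigma\otimes \mathrm{id})(\mathrm{id}\otimes \sigma)$ on $V^{\otimes 3}$. Write $\sigma_k=\mathrm{id}_V^{\otimes k-1}\otimes\sigma\otimes\mathrm{id}_V^{\otimes n-k-1}$ on $V^{\otimes n}$. A braided algebra $(A,m,\sigma)$ is an algebra $(A,m)$ with a braiding $\sigma$ on $A$ such that $(\mathrm{id}_A\otimes m)\sigma_1\sigma_2=\sigma(m\otimes\mathrm{id}_A)$ and $(m\otimes\mathrm{id}_A)\sigma_2\sigma_1=\sigma(\mathrm{id}_A\otimes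 m)$ on $A^{\otimes 3}$. A Rota-Baxter operator of weight $\lambda\in\mathbb{K}$ on an algebra $R$ is a linear endomorphism $P$ with $P(x)P(y)=P(xP(y))+P(P(x)y)+\lambda P(xy)$ for all $x,y\in R$. A right weak braided Rota-Baxter algebra of weight $\lambda$ is a triple $(R,P,\sigma')$ where $R$ with product $m'$ and braiding $\sigma'$ is a braided algebra and $P$ is a Rota-Baxter operator of weight $\lambda$ on $R$ with $\sigma'(P\otimes\mathrm{id}_R)=(\mathrm{id}_R\otimes P)\sigma'$. It is called commutative if $m'\circ\sigma'=m'$. For $w\in\mathfrak{S}_n$ with reduced expression $w=s_{k_1}\cdots s_{k_l}$, $s_k=(k\ k{+}1)$ (products are composition of maps, right factor first), $T^\sigma_w=\sigma_{k_1}\cdots\sigma_{k_l}$ on $A^{\otimes n}$ (independent of the reduced expression). For $i,j\ge1$, $\chi_{ij}\in\mathfrak{S}_{i+j}$ is given by $\chi_{ij}(r)=j+r$ for $1\le r\le i$ and $\chi_{ij}(i+r)=r$ for $1\le r\le j$; $\beta_{i,j}=T^\sigma_{\chi_{ij}}$, and $\beta_{0,i}=\beta_{i,0}=\mathrm{id}$. Quantum quasi-shuffle product: $\Join_\sigma$ is the bilinear product on $T(A)=\bigoplus_{n\ge0}A^{\otimes n}$ with $\lambda\Join_\sigma x=x\Join_\sigma\lambda=\lambda x$ for $\lambda\in\mathbb{K}=A^{\otimes0}$, and, with $\Join_{\sigma(i,j)}$ its restriction to $A^{\otimes i}\otimes A^{\otimes j}$, recursively for $i,j\ge1$ (with $u=a_1\otimes\cdots\otimes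 a_i$, $v=b_1\otimes\cdots\otimes b_j$, empty tensors equal to $1$): $$u\Join_\sigma v=a_1\otimes\big((a_2\otimes\cdots\otimes a_i)\Join_\sigma v\big)+(\mathrm{id}_A\otimes\Join_{\sigma(i,j-1)})(\beta_{i,1}\otimes\mathrm{id}_A^{\otimes j-1})(u\otimes v)+(m\otimes\Join_{\sigma(i-1,j-1)})(\mathrm{id}_A\otimes\beta_{i-1,1}\otimes\mathrm{id}_A^{\otimes j-1})(u\otimes v).$$ It is known that $(T(A),\Join_\sigma)$ is an associative algebra with unit $1\in\mathbb{K}$. *)

(* Defs.v *)
From HB Require Import structures.
From mathcomp Require Import fingroup perm.
From mathcomp Require Import all_boot all_algebra.
From mathcomp Require Import boolp.
From mathcomp.multinomials Require Import freeg.

Set Implicit Arguments.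
Unset Strict Implicit.
Unset Printing Implicit Defensive.

Import GRing.Theory.
Local Open Scope ring_scope.
Local Open Scope quotient_scope.

Section TensorDef.
Variables (K : fieldType) (V W : lmodType K).

Local Notation free := {freeg (V * W)%type / K}.
Local Notation gen v w := (<< (v, w) >> : free).

(* The submodule of the free module on V * W generated by the relations of
   bilinearity. *)
Inductive bilin_rel : free -> Prop :=
| bilin_rel0 : bilin_rel 0
| bilin_relD x y : bilin_rel x -> bilin_rel y -> bilin_rel (x + y)
| bilin_relZ a x : bilin_rel x -> bilin_rel (a *: x)
| bilin_relPl a v v' w :
    bilin_rel (gen (a *: v + v') w - (a *: gen v w + gen v' w))
| bilin_relPr a v w w' :
    bilin_rel (gen v (a *: w + w') - (a *: gen v w + gen v w')).

Definition bilin_pred (x : free) := `[< bilin_rel x >].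

Lemma bilin_pred_zmod_closed : zmod_closed bilin_pred.
Proof.
split=> [|x y]; first exact/asboolP/bilin_rel0.
move=> /asboolP hx /asboolP hy; apply/asboolP/bilin_relD => //.
by rewrite -scaleN1r; apply: bilin_relZ.
Qed.

HB.instance Definition _ :=
  GRing.isZmodClosed.Build free bilin_pred bilin_pred_zmod_closed.

Definition bilin_submod : zmodClosed free := GRing.ZmodClosed.clone _ bilin_pred _.

Definition tensor_quot : Type := Quotient.quot bilin_submod.
HB.instance Definition _ := GRing.Zmodule.on tensor_quot.
HB.instance Definition _ := Quotient.on tensor_quot.

Local Notation pit := (\pi_(Quotient.quot bilin_submod)).

Lemma pit_eqP (x y : free) : pit x = pit y <-> bilin_rel (x - y).
Proof.
split=> [/eqP|h]; first by rewrite -Quotient.idealrBE => /asboolP.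
by apply/eqP; rewrite -Quotient.idealrBE; apply/asboolP.
Qed.

Lemma pitD (x y : free) : pit (x + y) = pit x + pit y.
Proof. exact: raddfD. Qed.

Lemma pitK : cancel (@repr _ (Quotient.quot bilin_submod)) pit.
Proof. exact: reprK. Qed.

Definition tensor_scale (a : K) (x : tensor_quot) : tensor_quot :=
  pit (a *: repr (x : Quotient.quot bilin_submod)).

Lemma pitZ a (x : free) : pit (a *: x) = tensor_scale a (pit x).
Proof.
apply/pit_eqP; rewrite -scalerBr; apply: bilin_relZ.
by apply/pit_eqP; rewrite pitK.
Qed.

Lemma tensor_scaleA a b x :
  tensor_scale a (tensor_scale b x) = tensor_scale (a * b) x.
Proof. by rewrite -[x]pitK -!pitZ scalerA. Qed.
Lemma tensor_scale1 : left_id 1 tensor_scale.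
Proof. by move=> x; rewrite -[x]pitK -!pitZ scale1r. Qed.
Lemma tensor_scaleDr : right_distributive tensor_scale +%R.
Proof. by move=> a x y; rewrite -[x]pitK -[y]pitK -!pitZ -!pitD -pitZ scalerDr. Qed.
Lemma tensor_scaleDl x : {morph tensor_scale^~ x : a b / a + b}.
Proof. by move=> a b; rewrite -[x]pitK -!pitZ -!pitD scalerDl. Qed.

HB.instance Definition _ := GRing.Zmodule_isLmodule.Build K tensor_quot
  tensor_scaleA tensor_scale1 tensor_scaleDr tensor_scaleDl.

Definition tensor : lmodType K := tensor_quot.
Definition tpure (v : V) (w : W) : tensor := pit (gen v w).

Lemma tpure_bilinear : bilinear_for *:%R *:%R tpure.
Proof.
split=> u a x y; apply/etrans;
  [|exact/esym/(congr1 (+%R^~ _))/esym/pitZ | |exact/esym/(congr1 (+%R^~ _))/esym/pitZ];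
  rewrite -pitD; apply/pit_eqP; [exact: bilin_relPl|exact: bilin_relPr].
Qed.


Lemma tensor_ind (P : tensor -> Prop) :
    P 0 -> (forall x y, P x -> P y -> P (x + y)) ->
    (forall a v w, P (a *: tpure v w)) ->
  forall x, P x.
Proof.
move=> P0 PD PZ x; rewrite -[x]pitK -[repr _]freeg_sumE.
apply: (big_ind (fun y => P (pit y))) => [|y z|[v w] _].
- by have -> : pit 0 = 0 by exact: raddf0.
- by rewrite pitD; apply: PD.
set a := coeff _ _; have -> : << a *g (v, w) >> = a *: gen v w.
  by apply/eqP/freeg_eqP => k; rewrite coeffZ !coeffU mul1r.
by rewrite pitZ; apply: PZ.
Qed.

Section Lift.
Variables (U : lmodType K) (f : {bilinear V -> W -> U}).

Definition tlift_fun (x : tensor) : U :=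
  fglift (fun vw => f vw.1 vw.2) (repr (x : Quotient.quot bilin_submod)).

Let F : free -> U := fglift (fun vw => f vw.1 vw.2).
Let FB x y : F (x - y) = F x - F y.
Proof. exact: lift_is_additive. Qed.
Let F0 : F 0 = 0.
Proof. by have := FB 0 0; rewrite !subrr. Qed.
Let FD x y : F (x + y) = F x + F y.
Proof. by rewrite -[y in LHS]opprK FB -[- y]sub0r FB F0 sub0r opprK. Qed.
Let FU a v w : F << a *g (v, w) >> = a *: f v w.
Proof. exact: liftU. Qed.
Let FZ a x : F (a *: x) = a *: F x.
Proof.
rewrite -[x]freeg_sumE.
apply: (big_ind (fun y => F (a *: y) = a *: F y)) => [|y z|[v w] _].
- by rewrite scaler0 F0 scaler0.
- by rewrite scalerDr !FD scalerDr => -> ->.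
set b := coeff _ _; have -> : a *: << b *g (v, w) >> = << a * b *g (v, w) >>.
  by apply/eqP/freeg_eqP => k; rewrite coeffZ !coeffU mulrA.
by rewrite !FU scalerA.
Qed.

Let Frel x : bilin_rel x -> F x = 0.
Proof.
elim=> {x} [|x y _ hx _ hy|a x _ hx|a v v' w|a v w w'].
- exact: F0.
- by rewrite FD hx hy addr0.
- by rewrite FZ hx scaler0.
- by rewrite FB FD FZ !FU !scale1r linearPl subrr.
- by rewrite FB FD FZ !FU !scale1r linearPr subrr.
Qed.

Let tlift_pi x : tlift_fun (pit x) = F x.
Proof.
apply/eqP; rewrite -subr_eq0 -FB; apply/eqP/Frel/pit_eqP; exact: pitK.
Qed.

Lemma tlift_is_linear : linear tlift_fun.
Proof.
move=> a x y; rewrite -[x]pitK -[y]pitK.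
by rewrite -[a *: _]pitZ -[_ + _]pitD !tlift_pi FD FZ.
Qed.
HB.instance Definition _ := GRing.isLinear.Build K tensor U *:%R tlift_fun
  tlift_is_linear.

Definition tlift : {linear tensor -> U} := tlift_fun.

Lemma tliftE v w : tlift (tpure v w) = f v w.
Proof. by rewrite [LHS]tlift_pi FU scale1r. Qed.

End Lift.

Lemma tensor_lin_eq (U : lmodType K) (f g : {linear tensor -> U}) :
  (forall v w, f (tpure v w) = g (tpure v w)) -> f =1 g.
Proof.
move=> fg; elim/tensor_ind => [|x y hx hy|a v w]; first by rewrite !linear0.
  by rewrite !linearD hx hy.
by rewrite !linearZ /= fg.
Qed.

HB.instance Definition _ :=
  bilinear_isBilinear.Build K V W tensor *:%R *:%R tpure tpure_bilinear.

End TensorDef.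

Notation "V ⊗ W" := (tensor V W) (at level 40, left associativity).
Notation "v ⊗t w" := (tpure v w) (at level 40, left associativity).

Lemma mk_bilinear (K : fieldType) (U V W : lmodType K) (f : U -> V -> W) :
    (forall v a u u', f (a *: u + u') v = a *: f u v + f u' v) ->
    (forall u a v v', f u (a *: v + v') = a *: f u v + f u v') ->
  bilinear_for *:%R *:%R f.
Proof. by move=> fl fr; split=> u a x y; [apply: fl | apply: fr]. Qed.

Section PureLinear.
Variables (K : fieldType) (V W : lmodType K).

Definition tpurel_fun (v : V) (w : W) : V ⊗ W := v ⊗t w.
Lemma tpurel_fun_linear v : linear (tpurel_fun v).
Proof. by move=> a x y; rewrite /tpurel_fun linearPr. Qed.
HB.instance Definition _ v := GRing.isLinear.Build K W (V ⊗ W) *:%R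
  (tpurel_fun v) (tpurel_fun_linear v).
Definition tpurel v : {linear W -> V ⊗ W} := tpurel_fun v.

Definition tpurer_fun (w : W) (v : V) : V ⊗ W := v ⊗t w.
Lemma tpurer_fun_linear w : linear (tpurer_fun w).
Proof. by move=> a x y; rewrite /tpurer_fun linearPl. Qed.
HB.instance Definition _ w := GRing.isLinear.Build K V (V ⊗ W) *:%R
  (tpurer_fun w) (tpurer_fun_linear w).
Definition tpurer w : {linear V -> V ⊗ W} := tpurer_fun w.
End PureLinear.

Section TensorMaps.
Variable K : fieldType.
Implicit Types U V W X : lmodType K.

Section Map.
Variables (V W X Y : lmodType K) (f : {linear V -> X}) (g : {linear W -> Y}).
Definition tmap_fun (v : V) (w : W) : X ⊗ Y := f v ⊗t g w.
Lemma tmap_fun_bilinear : bilinear_for *:%R *:%R tmap_fun.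
Proof.
by apply: mk_bilinear => u a x y; rewrite /tmap_fun linearP ?linearPl ?linearPr.
Qed.
HB.instance Definition _ :=
  bilinear_isBilinear.Build K V W (X ⊗ Y) *:%R *:%R tmap_fun tmap_fun_bilinear.
Definition tmap : {linear V ⊗ W -> X ⊗ Y} := tlift tmap_fun.
Lemma tmapE v w : tmap (v ⊗t w) = f v ⊗t g w.
Proof. exact: tliftE. Qed.
End Map.


Section Assoc.
Variables U V W : lmodType K.

Section Left.
Variable w : W.
Definition tassoc_fun1 (u : U) (v : V) : U ⊗ (V ⊗ W) := u ⊗t (v ⊗t w).
Lemma tassoc_fun1_bilinear : bilinear_for *:%R *:%R tassoc_fun1.
Proof. by apply: mk_bilinear => u a x y; rewrite /tassoc_fun1 ?linearPl ?linearPr. Qed.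
HB.instance Definition _ := bilinear_isBilinear.Build K U V (U ⊗ (V ⊗ W))
  *:%R *:%R tassoc_fun1 tassoc_fun1_bilinear.
End Left.

Definition tassoc_fun (x : U ⊗ V) (w : W) : U ⊗ (V ⊗ W) :=
  tlift (tassoc_fun1 w) x.
Lemma tassoc_fun_bilinear : bilinear_for *:%R *:%R tassoc_fun.
Proof.
apply: mk_bilinear => [w a x y|x a w w']; first exact: linearP.
elim/tensor_ind: x => [|x y|b u v]; rewrite /tassoc_fun.
- by rewrite !linear0 addr0.
- by rewrite !linearD => -> ->; rewrite addrACA.
- have E w0 : tlift (tassoc_fun1 w0) (b *: (u ⊗t v)) = b *: (u ⊗t (v ⊗t w0)).
    by rewrite linearZ tliftE.
  by rewrite !E linearPr linearPr scalerDr !scalerA mulrC.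
Qed.
HB.instance Definition _ := bilinear_isBilinear.Build K (U ⊗ V) W
  (U ⊗ (V ⊗ W)) *:%R *:%R tassoc_fun tassoc_fun_bilinear.
Definition tassoc : {linear (U ⊗ V) ⊗ W -> U ⊗ (V ⊗ W)} := tlift tassoc_fun.
Lemma tassocE u v w : tassoc ((u ⊗t v) ⊗t w) = u ⊗t (v ⊗t w).
Proof. by rewrite /tassoc tliftE [LHS]tliftE. Qed.

Section Right.
Variable u : U.
Definition tassocV_fun1 (v : V) (w : W) : (U ⊗ V) ⊗ W := (u ⊗t v) ⊗t w.
Lemma tassocV_fun1_bilinear : bilinear_for *:%R *:%R tassocV_fun1.
Proof. by apply: mk_bilinear => v a x y; rewrite /tassocV_fun1 ?linearPr ?linearPl. Qed.
HB.instance Definition _ := bilinear_isBilinear.Build K V W ((U ⊗ V) ⊗ W)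
  *:%R *:%R tassocV_fun1 tassocV_fun1_bilinear.
End Right.

Definition tassocV_fun (u : U) (x : V ⊗ W) : (U ⊗ V) ⊗ W :=
  tlift (tassocV_fun1 u) x.
Lemma tassocV_fun_bilinear : bilinear_for *:%R *:%R tassocV_fun.
Proof.
apply: mk_bilinear => [x a u u'|w a x y]; last exact: linearP.
elim/tensor_ind: x => [|x y|b v w]; rewrite /tassocV_fun.
- by rewrite !linear0 addr0.
- by rewrite !linearD => -> ->; rewrite addrACA.
- have E u0 : tlift (tassocV_fun1 u0) (b *: (v ⊗t w)) = b *: ((u0 ⊗t v) ⊗t w).
    by rewrite linearZ tliftE.
  by rewrite !E linearPl linearPl scalerDr !scalerA mulrC.
Qed.
HB.instance Definition _ := bilinear_isBilinear.Build K U (V ⊗ W)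
  ((U ⊗ V) ⊗ W) *:%R *:%R tassocV_fun tassocV_fun_bilinear.
Definition tassocV : {linear U ⊗ (V ⊗ W) -> (U ⊗ V) ⊗ W} := tlift tassocV_fun.
Lemma tassocVE u v w : tassocV (u ⊗t (v ⊗t w)) = (u ⊗t v) ⊗t w.
Proof. by rewrite /tassocV tliftE [LHS]tliftE. Qed.
End Assoc.

Section Unitors.
Variable V : lmodType K.

Definition tunitl_fun (k : K^o) (v : V) : V := k *: v.
Lemma tunitl_fun_bilinear : bilinear_for *:%R *:%R tunitl_fun.
Proof.
apply: mk_bilinear => [v a x y|x a v w]; rewrite /tunitl_fun; first by rewrite scalerDl scalerA.
by rewrite scalerDr !scalerA mulrC.
Qed.
HB.instance Definition _ := bilinear_isBilinear.Build K K^o V V *:%R *:%R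
  tunitl_fun tunitl_fun_bilinear.
Definition tunitl : {linear K^o ⊗ V -> V} := tlift tunitl_fun.
Lemma tunitlE k v : tunitl (k ⊗t v) = k *: v.
Proof. exact: tliftE. Qed.

Definition tunitr_fun (v : V) (k : K^o) : V := k *: v.
Lemma tunitr_fun_bilinear : bilinear_for *:%R *:%R tunitr_fun.
Proof.
apply: mk_bilinear => [x a v w|v a x y]; rewrite /tunitr_fun; last by rewrite scalerDl scalerA.
by rewrite scalerDr !scalerA mulrC.
Qed.
HB.instance Definition _ := bilinear_isBilinear.Build K V K^o V *:%R *:%R
  tunitr_fun tunitr_fun_bilinear.
Definition tunitr : {linear V ⊗ K^o -> V} := tlift tunitr_fun.
Lemma tunitrE v k : tunitr (v ⊗t k) = k *: v.
Proof. exact: tliftE. Qed.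

Definition tunitrV_fun (v : V) : V ⊗ K^o := v ⊗t (1 : K^o).
Lemma tunitrV_fun_linear : linear tunitrV_fun.
Proof. by move=> a x y; rewrite /tunitrV_fun linearPl. Qed.
HB.instance Definition _ := GRing.isLinear.Build K V (V ⊗ K^o) *:%R tunitrV_fun
  tunitrV_fun_linear.
Definition tunitrV : {linear V -> V ⊗ K^o} := tunitrV_fun.
End Unitors.

End TensorMaps.

Arguments tassoc {K U V W}.
Arguments tassocV {K U V W}.
Arguments tunitl {K V}.
Arguments tunitr {K V}.
Arguments tunitrV {K V}.
Notation "f ⊗m g" := (tmap f g) (at level 40, left associativity).

Section DirectSum.
Variables (K : fieldType) (V : nat -> lmodType K).

Record dsum_fun := DSum {
  dcoord :> forall n, V n;
  dcoord_finite : exists N, forall n, (N <= n)%N -> dcoord n = 0 }.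

Lemma dsum_eq (x y : dsum_fun) : (forall n, x n = y n) -> x = y.
Proof.
case: x y => [x hx] [y hy] /= xy.
have {}xy : x = y by apply: functional_extensionality_dep.
by case: _ / xy in hy *; congr DSum; apply: Prop_irrelevance.
Qed.

HB.instance Definition _ := gen_eqMixin dsum_fun.
HB.instance Definition _ := gen_choiceMixin dsum_fun.

Lemma dsum0_finite : exists N, forall n, (N <= n)%N -> (0 : V n) = 0.
Proof. by exists 0%N. Qed.
Lemma dsumD_finite (x y : dsum_fun) :
  exists N, forall n, (N <= n)%N -> x n + y n = 0.
Proof.
have [[M hx] [N hy]] := (dcoord_finite x, dcoord_finite y).
exists (maxn M N) => n; rewrite geq_max => /andP[Mn Nn].
by rewrite hx // hy // addr0.
Qed.
Lemma dsumN_finite (x : dsum_fun) : exists N, forall n, (N <= n)%N -> - x n = 0.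
Proof.
by have [N hx] := dcoord_finite x; exists N => n /hx ->; rewrite oppr0.
Qed.
Lemma dsumZ_finite a (x : dsum_fun) :
  exists N, forall n, (N <= n)%N -> a *: x n = 0.
Proof.
by have [N hx] := dcoord_finite x; exists N => n /hx ->; rewrite scaler0.
Qed.

Definition dsum_zero := DSum dsum0_finite.
Definition dsum_add x y := DSum (dsumD_finite x y).
Definition dsum_opp x := DSum (dsumN_finite x).
Definition dsum_scale a x := DSum (dsumZ_finite a x).

Lemma dsum_addA : associative dsum_add.
Proof. by move=> x y z; apply: dsum_eq => n /=; rewrite addrA. Qed.
Lemma dsum_addC : commutative dsum_add.
Proof. by move=> x y; apply: dsum_eq => n /=; rewrite addrC. Qed.
Lemma dsum_add0 : left_id dsum_zero dsum_add.
Proof. by move=> x; apply: dsum_eq => n /=; rewrite add0r. Qed.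
Lemma dsum_addN : left_inverse dsum_zero dsum_opp dsum_add.
Proof. by move=> x; apply: dsum_eq => n /=; rewrite addNr. Qed.
HB.instance Definition _ := GRing.isZmodule.Build dsum_fun
  dsum_addA dsum_addC dsum_add0 dsum_addN.

Lemma dsum_scaleA a b x : dsum_scale a (dsum_scale b x) = dsum_scale (a * b) x.
Proof. by apply: dsum_eq => n /=; rewrite scalerA. Qed.
Lemma dsum_scale1 : left_id 1 dsum_scale.
Proof. by move=> x; apply: dsum_eq => n /=; rewrite scale1r. Qed.
Lemma dsum_scaleDr : right_distributive dsum_scale +%R.
Proof. by move=> a x y; apply: dsum_eq => n /=; rewrite scalerDr. Qed.
Lemma dsum_scaleDl x : {morph dsum_scale^~ x : a b / a + b}.
Proof. by move=> a b; apply: dsum_eq => n /=; rewrite scalerDl. Qed.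
HB.instance Definition _ := GRing.Zmodule_isLmodule.Build K dsum_fun
  dsum_scaleA dsum_scale1 dsum_scaleDr dsum_scaleDl.

Definition dsum : lmodType K := dsum_fun.

Definition dinj_fun (n : nat) (v : V n) (m : nat) : V m :=
  if @eqP _ n m is ReflectT e then ecast i (V i) e v else 0.
Lemma dinj_finite n (v : V n) :
  exists N, forall m, (N <= m)%N -> dinj_fun v m = 0.
Proof.
exists n.+1 => m nm; rewrite /dinj_fun; case: eqP => // e.
by rewrite e ltnn in nm.
Qed.
Definition dinj_def n (v : V n) : dsum := DSum (dinj_finite v).

Lemma dinj_eq n (v : V n) : dinj_fun v n = v.
Proof. by rewrite /dinj_fun; case: eqP => // e; rewrite eq_axiomK. Qed.
Lemma dinj_neq n (v : V n) m : n != m -> dinj_fun v m = 0.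
Proof. by rewrite /dinj_fun; case: eqP. Qed.

Lemma dinj_is_linear n : linear (@dinj_def n).
Proof.
move=> a x y; apply: dsum_eq => m.
case: (eqVneq n m) => [<-|nm]; first by rewrite /= !dinj_eq.
by rewrite /= !dinj_neq // scaler0 addr0.
Qed.
HB.instance Definition _ n := GRing.isLinear.Build K (V n) dsum *:%R
  (@dinj_def n) (@dinj_is_linear n).
Definition dinj n : {linear V n -> dsum} := @dinj_def n.

Definition dbound (x : dsum) : nat := sval (cid (dcoord_finite x)).
Lemma dboundP (x : dsum) n : (dbound x <= n)%N -> x n = 0.
Proof. by rewrite /dbound; case: cid => N /= h /h. Qed.

Lemma sum_dbound (U : lmodType K) (f : forall n, V n -> U) (x : dsum) N :
    (forall n, f n 0 = 0) -> (forall n, (N <= n)%N -> x n = 0) ->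
  \sum_(n < dbound x) f n (x n) = \sum_(n < N) f n (x n).
Proof.
move=> f0 xN; pose F n := f n (x n).
have F0 M m : (forall n, (M <= n)%N -> x n = 0) -> (M <= m)%N ->
    \sum_(n < m) F n = \sum_(n < M) F n.
  move=> xM Mm; rewrite -!(big_mkord xpredT F).
  rewrite (big_cat_nat (n := M)) //= -[RHS]addr0.
  congr (_ + _); rewrite big_nat big1 //.
  by move=> n /andP[/xM Fn _]; rewrite /F Fn f0.
pose M := maxn (dbound x) N.
rewrite -[LHS](F0 _ M) ?leq_maxl //; last exact: dboundP.
by rewrite (F0 N) ?leq_maxr.
Qed.

Section Lift.
Variables (U : lmodType K) (f : forall n, {linear V n -> U}).

Definition dlift_fun (x : dsum) : U := \sum_(n < dbound x) f n (x n).
Lemma dlift_is_linear : linear dlift_fun.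
Proof.
move=> a x y; pose N := maxn (dbound x) (dbound y).
have xN n : (N <= n)%N -> x n = 0.
  by rewrite geq_max => /andP[/dboundP].
have yN n : (N <= n)%N -> y n = 0.
  by rewrite geq_max => /andP[_ /dboundP].
have zN n : (N <= n)%N -> (a *: x + y) n = 0.
  by move=> Nn; rewrite /= xN // yN // scaler0 addr0.
rewrite /dlift_fun.
rewrite (sum_dbound (f := f) _ xN); last by move=> n; rewrite linear0.
rewrite (sum_dbound (f := f) _ yN); last by move=> n; rewrite linear0.
rewrite (sum_dbound (f := f) _ zN); last by move=> n; rewrite linear0.
rewrite scaler_sumr -big_split; apply: eq_bigr => n _; exact: linearP.
Qed.
HB.instance Definition _ := GRing.isLinear.Build K dsum U *:%R dlift_fun
  dlift_is_linear.
Definition dlift : {linear dsum -> U} := dlift_fun.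

Lemma dliftE n v : dlift (dinj n v) = f n v.
Proof.
rewrite [LHS](sum_dbound (f := f) (N := n.+1)).
- rewrite big_ord_recr /= dinj_eq big1 ?add0r // => i _.
  by rewrite dinj_neq ?linear0 // gtn_eqF.
- by move=> m; rewrite linear0.
- by move=> m nm; rewrite /= dinj_neq // ltn_eqF.
Qed.
End Lift.

Lemma dsum_sum (x : dsum) : x = \sum_(n < dbound x) dinj n (x n).
Proof.
apply: dsum_eq => m.
have coordB n (F : 'I_n -> dsum) : (\sum_i F i) m = \sum_i F i m.
  elim: n F => [|n ih] F; first by rewrite !big_ord0.
  by rewrite !big_ord_recr /= ih.
rewrite coordB; have [mx|xm] := ltnP m (dbound x).
  rewrite (bigD1 (Ordinal mx)) //= dinj_eq big1 ?addr0 // => i im.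
  by rewrite /= dinj_neq.
rewrite dboundP // big1 // => i _; rewrite /= dinj_neq // ltn_eqF //.
exact: leq_trans xm.
Qed.

Lemma dsum_lin_eq (U : lmodType K) (f g : {linear dsum -> U}) :
  (forall n v, f (dinj n v) = g (dinj n v)) -> f =1 g.
Proof.
by move=> fg x; rewrite [x]dsum_sum !linear_sum; apply: eq_bigr => i _.
Qed.

End DirectSum.

Arguments dinj {K V} n.

Section DirectSumTensor.
Variables (K : fieldType) (V W : nat -> lmodType K) (U : lmodType K).
Variable f : forall i j, {linear V i ⊗ W j -> U}.

Definition dlift2_fun (x : dsum V) (y : dsum W) : U :=
  \sum_(i < dbound x) \sum_(j < dbound y) f i j (x i ⊗t y j).

Let rowf (y : dsum W) i (v : V i) := \sum_(j < dbound y) f i j (v ⊗t y j).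
Let rowf_linear y i : linear (@rowf y i).
Proof.
move=> a u v; rewrite /rowf scaler_sumr -big_split; apply: eq_bigr => j _.
by rewrite linearPl linearP.
Qed.
HB.instance Definition _ y i := GRing.isLinear.Build K (V i) U *:%R
  (@rowf y i) (@rowf_linear y i).
Let colf (x : dsum V) j (w : W j) := \sum_(i < dbound x) f i j (x i ⊗t w).
Let colf_linear x j : linear (@colf x j).
Proof.
move=> a u v; rewrite /colf scaler_sumr -big_split; apply: eq_bigr => i _.
by rewrite linearPr linearP.
Qed.
HB.instance Definition _ x j := GRing.isLinear.Build K (W j) U *:%R
  (@colf x j) (@colf_linear x j).
Let dlift2_row x y : dlift2_fun x y = dlift (fun i => @rowf y i) x.
Proof. by []. Qed.
Let dlift2_col x y : dlift2_fun x y = dlift (fun j => @colf x j) y.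
Proof. by rewrite /dlift2_fun exchange_big. Qed.

Lemma dlift2_fun_bilinear : bilinear_for *:%R *:%R dlift2_fun.
Proof.
apply: mk_bilinear => [y a x x'|x a y y']; first by rewrite !dlift2_row linearP.
by rewrite !dlift2_col linearP.
Qed.
HB.instance Definition _ := bilinear_isBilinear.Build K (dsum V) (dsum W) U
  *:%R *:%R dlift2_fun dlift2_fun_bilinear.
Definition dlift2 : {linear dsum V ⊗ dsum W -> U} := tlift dlift2_fun.

Lemma dlift2E i j v w : dlift2 (dinj i v ⊗t dinj j w) = f i j (v ⊗t w).
Proof.
rewrite /dlift2 tliftE [LHS]dlift2_row dliftE.
by rewrite [LHS](dliftE (fun j => f i j \o tpurel (W j) v)).
Qed.
End DirectSumTensor.

(* A product on V is a linear map m : V ⊗ V -> V; MathComp algebras are not used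
   because they are unital and nonzero. The space V ⊗ V ⊗ V is represented as
   V ⊗ (V ⊗ V). *)

Section Braided.
Variable K : fieldType.

(* phi acting on the first two factors of V ⊗ V ⊗ W *)
Definition act12 (V W : lmodType K) (phi : {linear V ⊗ V -> V ⊗ V}) :
    {linear V ⊗ (V ⊗ W) -> V ⊗ (V ⊗ W)} :=
  tassoc \o (phi ⊗m @idfun W) \o tassocV.

Variable V : lmodType K.
Implicit Types (m : {linear V ⊗ V -> V}) (sigma : {linear V ⊗ V -> V ⊗ V}).

Definition braiding sigma : Prop :=
  let sigma1 := act12 V sigma in
  let sigma2 := @idfun V ⊗m sigma in
  bijective sigma /\
  forall x : V ⊗ (V ⊗ V),
    sigma1 (sigma2 (sigma1 x)) = sigma2 (sigma1 (sigma2 x)).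

Definition assoc_product m : Prop :=
  forall x y z : V, m (m (x ⊗t y) ⊗t z) = m (x ⊗t m (y ⊗t z)).

Definition unit_element m (e : V) : Prop :=
  forall x : V, m (e ⊗t x) = x /\ m (x ⊗t e) = x.

Record braided_algebra m sigma : Prop := BraidedAlgebra {
  braided_assoc : assoc_product m;
  braided_braiding : braiding sigma;
  braided_mull : forall x : V ⊗ (V ⊗ V),
    (@idfun V ⊗m m) (act12 V sigma ((@idfun V ⊗m sigma) x))
    = sigma ((m ⊗m @idfun V) (tassocV x));
  braided_mulr : forall x : V ⊗ (V ⊗ V),
    (m ⊗m @idfun V) (tassocV ((@idfun V ⊗m sigma) (act12 V sigma x)))
    = sigma ((@idfun V ⊗m m) x) }.

Definition Rota_Baxter (lambda : K) m (P : {linear V -> V}) : Prop :=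
  forall x y : V,
    m (P x ⊗t P y)
    = P (m (x ⊗t P y)) + P (m (P x ⊗t y)) + lambda *: P (m (x ⊗t y)).

Record right_weak_braided_RB (lambda : K) m sigma (P : {linear V -> V}) : Prop :=
  RightWeakBraidedRB {
    rwbRB_braided : braided_algebra m sigma;
    rwbRB_RB : Rota_Baxter lambda m P;
    rwbRB_weak : forall x : V ⊗ V,
      sigma ((P ⊗m @idfun V) x) = (@idfun V ⊗m P) (sigma x) }.

Definition braided_commutative m sigma : Prop :=
  forall x : V ⊗ V, m (sigma x) = m x.

End Braided.

Definition algebra_map (K : fieldType) (V W : lmodType K)
    (mV : {linear V ⊗ V -> V}) (mW : {linear W ⊗ W -> W})
    (f : {linear V -> W}) : Prop :=
  forall x y : V, f (mV (x ⊗t y)) = mW (f x ⊗t f y).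

Section Words.
Variable n : nat.

Definition simple_transp (k : 'I_n) : 'S_n.+1 :=
  tperm (widen_ord (leqnSn n) k) (fintype.lift ord0 k).

(* The composite of maps s_{k_1} o ... o s_{k_l}; MathComp composes permutations
   from left to right, hence rev. *)
Definition word_perm (ks : seq 'I_n) : 'S_n.+1 :=
  (\prod_(k <- rev ks) simple_transp k)%g.

Definition reduced_expr (w : 'S_n.+1) (ks : seq 'I_n) : Prop :=
  word_perm ks = w /\
  forall ks', word_perm ks' = w -> (size ks <= size ks')%N.

Let gend (w : 'S_n.+1) := exists ks, w = word_perm ks.

Let gendM v w : gend v -> gend w -> gend (v * w)%g.
Proof.
move=> [ks ->] [ls ->]; exists (ls ++ ks).
by rewrite /word_perm rev_cat big_cat.
Qed.

Let gend1 : gend 1%g.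
Proof. by exists [::]; rewrite /word_perm big_nil. Qed.

Let gend_tperm_lt d (x y : 'I_n.+1) : (y = x + d :> nat)%N -> gend (tperm x y).
Proof.
elim: d x y => [|d ih] x y yE.
  have -> : y = x by apply: val_inj; rewrite /= yE addn0.
  by rewrite tperm1.
have yn : (x + d < n)%N by rewrite -ltnS -addnS -yE.
pose k := Ordinal yn; pose z : 'I_n.+1 := widen_ord (leqnSn n) k.
have gk : gend (simple_transp k).
  by exists [:: k]; rewrite /word_perm big_seq1.
have kE : simple_transp k = tperm z y.
  by congr tperm; apply: val_inj; rewrite /= /bump yE addnS.
case: (posnP d) => [d0|dp].
  have -> : x = z by apply: val_inj; rewrite /= d0 addn0.
  by rewrite -kE.
have -> : tperm x y = (tperm x z ^ tperm z y)%g.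
  rewrite tpermJ tpermL tpermD //; apply/eqP => /(congr1 val) /= /eqP.
    by rewrite -[X in _ == X]addn0 eqn_add2l (gtn_eqF dp).
  by rewrite yE -[X in _ == X]addn0 eqn_add2l.
rewrite conjgE tpermV -kE; apply: gendM => //; apply: gendM => //.
exact: ih.
Qed.

Lemma word_perm_surj (w : 'S_n.+1) : exists ks, w = word_perm ks.
Proof.
have [ts -> _] := prod_tpermP w.
elim/big_rec: _ => [|[x y] v _ gv]; first exact: gend1.
apply: gendM => //=; have [xy|/ltnW yx] := leqP x y.
  by apply: (@gend_tperm_lt (y - x)); rewrite subnKC.
by rewrite tpermC; apply: (@gend_tperm_lt (x - y)); rewrite subnKC.
Qed.

Lemma reduced_expr_exists (w : 'S_n.+1) : exists ks, reduced_expr w ks.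
Proof.
pose p l := `[< exists2 ks, word_perm ks = w & size ks = l >].
have ex : exists l, p l.
  by have [ks kw] := word_perm_surj w; exists (size ks); apply/asboolP; exists ks.
case: (ex_minnP ex) => l /asboolP[ks ksw <-] lmin.
by exists ks; split=> // ks' ks'w; apply/lmin/asboolP; exists ks'.
Qed.

Definition reduced_word (w : 'S_n.+1) : seq 'I_n :=
  sval (cid (reduced_expr_exists w)).
Lemma reduced_wordP w : reduced_expr w (reduced_word w).
Proof. exact: svalP (cid (reduced_expr_exists w)). Qed.

End Words.

(* chi_{i,j} on {0, ..., i + j - 1}; the values are given by nat formulas, and
   inord never leaves its range. *)
Section Chi.
Variables (i j n : nat) (ijn : (i + j = n.+1)%N).

Definition chi_fun (r : 'I_n.+1) : 'I_n.+1 :=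
  inord (if r < i then j + r else r - i)%N.

Lemma chi_funE (r : 'I_n.+1) :
  chi_fun r = (if r < i then j + r else r - i)%N :> nat.
Proof.
rewrite inordK //; case: ifP => [ri|_].
  by rewrite -[X in (_ < X)%N]ijn addnC ltn_add2r.
exact: leq_ltn_trans (leq_subr _ _) (ltn_ord r).
Qed.

Lemma chi_fun_inj : injective chi_fun.
Proof.
move=> r s /(congr1 val) /=; rewrite !chi_funE => rs; apply: val_inj => /=.
have lt_sub (t : 'I_n.+1) : (i <= t)%N -> (t - i < j)%N.
  by move=> it; rewrite ltn_subLR // ijn.
case: (ltnP r i) (ltnP s i) rs => [ri|ir] [si|is_] rs.
- exact: addnI rs.
- by have := lt_sub _ is_; rewrite -rs ltnNge leq_addr.
- by have := lt_sub _ ir; rewrite rs ltnNge leq_addr.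
- by rewrite -(subnKC ir) -(subnKC is_) rs.
Qed.

Definition chi : 'S_n.+1 := perm chi_fun_inj.

Lemma chiE (r : 'I_n.+1) : chi r = (if r < i then j + r else r - i)%N :> nat.
Proof. by rewrite permE chi_funE. Qed.
End Chi.

Section QuasiShuffle.
Variables (K : fieldType) (A : lmodType K).

(* The powers are nested to the right and end in the ground field, so that the
   first power is A ⊗ K^o, with a in A represented by a ⊗ 1. *)
Fixpoint tpow (n : nat) : lmodType K :=
  if n is n'.+1 then A ⊗ tpow n' else K^o.

Definition tensor_alg : lmodType K := dsum tpow.

(* u ⊗ a as an element of the next tensor power *)
Fixpoint tsnoc (n : nat) : {linear tpow n ⊗ A -> tpow n.+1} :=
  match n return {linear tpow n ⊗ A -> tpow n.+1} with
  | 0 => tunitrV \o tunitl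
  | n'.+1 => (@idfun A ⊗m tsnoc n') \o tassoc
  end.

(* a ⊗ x in T(A), for a in A and x in T(A) *)
Section Cons.
Variables (a : A) (x : tensor_alg).
Definition tcons_coord (n : nat) : tpow n :=
  if n is n'.+1 then a ⊗t x n' else 0.
Lemma tcons_finite : exists N, forall n, (N <= n)%N -> tcons_coord n = 0.
Proof.
have [N xN] := dcoord_finite x; exists N.+1 => -[|n] // Nn.
by rewrite /= xN // linear0r.
Qed.
Definition tcons_fun : tensor_alg := DSum tcons_finite.
End Cons.

Lemma tcons_fun_bilinear : bilinear_for *:%R *:%R tcons_fun.
Proof.
apply: mk_bilinear => [x b a a'|a b x x']; apply: dsum_eq => -[|n] /=;
  by rewrite ?linearPl ?linearPr // scaler0 addr0.
Qed.
HB.instance Definition _ := bilinear_isBilinear.Build K A tensor_alg tensor_alg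
  *:%R *:%R tcons_fun tcons_fun_bilinear.
Definition tcons : {linear A ⊗ tensor_alg -> tensor_alg} := tlift tcons_fun.

Variables (m : {linear A ⊗ A -> A}) (sigma : {linear A ⊗ A -> A ⊗ A}).

(* sigma acting on the factors k and k.+1 (counted from 0) of the n-th power;
   the value is irrelevant for n <= k.+1. *)
Fixpoint sigma_at (n k : nat) : {linear tpow n -> tpow n} :=
  match n return {linear tpow n -> tpow n} with
  | n'.+1 =>
      match k with
      | k'.+1 => @idfun A ⊗m sigma_at n' k'
      | 0 => match n' return {linear tpow n'.+1 -> tpow n'.+1} with
             | n''.+1 => act12 (tpow n'') sigma
             | 0 => idfun
             end
      end
  | 0 => idfun
  end.

Definition sigma_word (n : nat) (ks : seq 'I_n) :
    {linear tpow n.+1 -> tpow n.+1} :=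
  foldr (fun (k : 'I_n) (phi : {linear tpow n.+1 -> tpow n.+1}) =>
           (sigma_at n.+1 k \o phi : {linear tpow n.+1 -> tpow n.+1}))
        (idfun : {linear tpow n.+1 -> tpow n.+1}) ks.

Definition T_sigma (n : nat) (w : 'S_n.+1) : {linear tpow n.+1 -> tpow n.+1} :=
  sigma_word (reduced_word w).

(* beta_{i,j} acts on the power i + j = n.+1. For i = 0 or j = 0, chi_{i,j} is
   the identity, whose reduced word is empty. *)
Definition beta (i j n : nat) (ijn : (i + j = n.+1)%N) :
    {linear tpow n.+1 -> tpow n.+1} := T_sigma (chi ijn).

(* beta_{i,1}, with source and target written as tpow i ⊗ A and A ⊗ tpow i *)
Definition beta1 (i : nat) : {linear tpow i ⊗ A -> A ⊗ tpow i} :=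
  beta (addn1 i) \o tsnoc i.

(* (beta_{i,1} ⊗ id) (u ⊗ v), for u in tpow i and v in tpow j.+1 *)
Definition beta1_id (i j : nat) :
    {linear tpow i ⊗ tpow j.+1 -> A ⊗ (tpow i ⊗ tpow j)} :=
  tassoc \o (beta1 i ⊗m @idfun (tpow j)) \o tassocV.

(* The three summands are those of the recursive definition of the product of
   u = a_1 ⊗ u' and v in A^{⊗ i'.+1} and A^{⊗ j'.+1}; the values lie in T(A), as
   the third summand lowers the degree. *)
Fixpoint qsh_hom (i : nat) :
    forall j, {linear tpow i ⊗ tpow j -> tensor_alg} :=
  match i return forall j, {linear tpow i ⊗ tpow j -> tensor_alg} with
  | 0 => fun j => dinj j \o tunitl
  | i'.+1 =>
      fix qsh_r (j : nat) : {linear tpow i'.+1 ⊗ tpow j -> tensor_alg} :=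
        match j return {linear tpow i'.+1 ⊗ tpow j -> tensor_alg} with
        | 0 => dinj i'.+1 \o tunitr
        | j'.+1 =>
            (tcons \o (@idfun A ⊗m qsh_hom i' j'.+1) \o tassoc)
            \+ (tcons \o (@idfun A ⊗m qsh_r j') \o beta1_id i'.+1 j')
            \+ (tcons \o (m ⊗m qsh_hom i' j') \o tassocV
                \o (@idfun A ⊗m beta1_id i' j') \o tassoc)
        end
  end.

Definition qsh : {linear tensor_alg ⊗ tensor_alg -> tensor_alg} :=
  dlift2 qsh_hom.

Lemma qsh_unitl (x : tensor_alg) : qsh (dinj 0 (1 : K^o) ⊗t x) = x.
Proof.
pose g : {linear tensor_alg -> tensor_alg} := qsh \o tpurel _ (dinj 0 (1 : K^o)).
apply: (@dsum_lin_eq _ _ _ g idfun) => n v.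
by rewrite [LHS]dlift2E /= tunitlE scale1r.
Qed.

Lemma qsh_unitr (x : tensor_alg) : qsh (x ⊗t dinj 0 (1 : K^o)) = x.
Proof.
pose g : {linear tensor_alg -> tensor_alg} :=
  qsh \o tpurer _ (dinj 0 (1 : K^o)).
apply: (@dsum_lin_eq _ _ _ g idfun) => -[|n] v.
  by rewrite [LHS]dlift2E /= tunitlE; congr (dinj 0 _); rewrite [LHS]mulr1.
by rewrite [LHS]dlift2E /= tunitrE scale1r.
Qed.

End QuasiShuffle.

Section Fbar.
Variables (K : fieldType) (A R : lmodType K).
Variables (mR : {linear R ⊗ R -> R}) (oneR : R) (P : {linear R -> R}).
Variable f : {linear A -> R}.

Definition scal_unit_fun (k : K^o) : R := k *: oneR.
Lemma scal_unit_linear : linear scal_unit_fun.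
Proof. by move=> a x y; rewrite /scal_unit_fun scalerDl scalerA. Qed.
HB.instance Definition _ := GRing.isLinear.Build K K^o R *:%R scal_unit_fun
  scal_unit_linear.

Fixpoint fbar_hom (n : nat) : {linear tpow A n -> R} :=
  match n return {linear tpow A n -> R} with
  | 0 => scal_unit_fun
  | n'.+1 =>
      match n' return {linear tpow A n' -> R} -> {linear tpow A n'.+1 -> R} with
      | 0 => fun _ => P \o f \o tunitr
      | n''.+1 => fun fbar' => P \o mR \o (f ⊗m fbar')
      end (fbar_hom n')
  end.

Definition fbar : {linear tensor_alg A -> R} := dlift fbar_hom.

Lemma fbar_unit : fbar (dinj (V := tpow A) 0 (1 : K^o)) = oneR.
Proof. by rewrite /fbar dliftE /= /scal_unit_fun scale1r. Qed.

Lemma fbar_letter a : fbar (dinj 1 (a ⊗t (1 : K^o) : tpow A 1)) = P (f a).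
Proof. by rewrite /fbar dliftE /= tunitrE scale1r. Qed.

Lemma fbar_cons n a (x : tpow A n.+1) :
  fbar (dinj n.+2 (a ⊗t x : tpow A n.+2))
  = P (mR (f a ⊗t fbar (dinj n.+1 x))).
Proof.
have -> : fbar (dinj n.+1 x) = fbar_hom n.+1 x by exact: dliftE.
have -> : fbar (dinj n.+2 (a ⊗t x : tpow A n.+2))
  = fbar_hom n.+2 (a ⊗t x) by exact: dliftE.
by congr (P (mR _)); exact: tmapE.
Qed.

End Fbar.

(* Main.v *)
Require Import Defs.
From mathcomp Require Import all_boot all_algebra.
From mathcomp Require Import fingroup perm.

(** Write F for the map induced by f on tensor powers, so that
    F (a ⊗ u) = P (f a * F u) in every degree, including F a = P (f a * 1).
    For words a ⊗ u and b ⊗ v put x = f a * F u and y = f b * F v. Then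
    F (a ⊗ u) * F (b ⊗ v) = P x * P y, and the Rota-Baxter identity of weight 1
    splits this into P (x * P y) + P (P x * y) + P (x * y). These three terms
    match one by one the three terms of the recursive definition of the quantum
    quasi-shuffle product, and one concludes by induction on the two degrees:
    - x * P y = f a * (F u * F (b ⊗ v)), which is the first term;
    - P x * y = F (a ⊗ u) * f b * F v, where the letter b has to be moved to the
      left of the word a ⊗ u, and the second term does that with beta_{i,1};
    - x * y = f a * F u * f b * F v, where b has to be moved across u, after
      which f a * f b = f (a * b); this is the third term.

    So everything rests on the rule for moving a letter across a word,
    m (f ⊗ F) beta_{n,1} (u ⊗ b) = F u * f b ([mul_fbar_beta1]). By
    commutativity of R it follows from the stronger relation
    (f ⊗ F) beta_{n,1} (u ⊗ b) = sigma' (F u ⊗ f b) ([fbar_beta1]), which is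
    proved by induction on the length of u: sigma' commutes with P in its left
    argument, and passes through a product one factor at a time. This
    covers the nonempty words; for the empty word the rule is the unit law.

    The induction needs the recursion beta_{n+1,1} = sigma_1 (id ⊗ beta_{n,1})
    ([beta1S]). As beta is defined through an unspecified reduced word, this
    requires knowing that chi_{n,1} has only one reduced word, s_1 ... s_n
    ([reduced_word_chi1]). *)

Set Implicit Arguments.
Unset Strict Implicit.
Unset Printing Implicit Defensive.

Import GRing.Theory.
Local Open Scope ring_scope.

(** * The reduced word of the cycle chi_{n,1} *)

Lemma word_perm_cons (n : nat) (k : 'I_n) (ks : seq 'I_n) (x : 'I_n.+1) :
  word_perm (k :: ks) x = simple_transp k (word_perm ks x).
Proof. by rewrite /word_perm rev_cons big_rcons permM. Qed.

Lemma word_perm_nil (n : nat) (x : 'I_n.+1) : @word_perm n [::] x = x.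
Proof. by rewrite /word_perm big_nil perm1. Qed.

Lemma simple_transpE (n : nat) (k : 'I_n) (x : 'I_n.+1) :
  simple_transp k x
  = (if x == k :> nat then k.+1 else if x == k.+1 :> nat then k : nat else x)
    :> nat.
Proof.
rewrite /simple_transp permE /= -!val_eqE /= /bump leq0n add1n.
by case: eqP => // _; case: eqP.
Qed.

(** Each letter of a word lowers a point by at most one. Hence a word of length l
    lowers no point by more than l, and if it lowers x by exactly l then every
    letter has to act on the current position of x, which determines the whole
    word. *)
Lemma word_perm_descent (n : nat) (ks : seq 'I_n) (x : 'I_n.+1) :
  (x <= word_perm ks x + size ks)%N /\
  (x = word_perm ks x + size ks :> nat ->
   map val ks = iota (word_perm ks x) (size ks))%N.
Proof.
elim: ks => [|k ks [le_x eq_x]]; first by rewrite word_perm_nil addn0.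
rewrite word_perm_cons /=; set z := word_perm ks x in le_x eq_x *.
rewrite simple_transpE addnS; case: (eqVneq (z : nat) k) => [zk|_].
  rewrite zk in le_x; split; first by rewrite addSn; apply/leqW/leqW.
  by move=> xE; rewrite xE addSn ltnNge leqnSn in le_x.
case: (eqVneq (z : nat) k.+1) => [zk|_].
  rewrite zk addSn in le_x eq_x.
  by split=> // /eq_x ->.
by split=> [|xE]; [exact: leqW | rewrite xE ltnn in le_x].
Qed.

(** This provides a word of length n for chi_{n,1}, which bounds the length of
    the reduced ones. *)
Lemma word_perm_iota (n : nat) (ks : seq 'I_n) (y : nat) (x : 'I_n.+1) :
    map val ks = iota y (size ks) ->
  word_perm ks x = (if x < y then x : nat
                    else if x < y + size ks then x.+1
                    else if x == y + size ks :> nat then y else x)%N :> nat.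
Proof.
elim: ks y => [|k ks ih] y /=.
  rewrite word_perm_nil addn0 => _; case: ltngtP => //.
case=> ky /ih ksE; rewrite word_perm_cons simple_transpE ksE ky.
rewrite addSn addnS; clear.
have [xy|yx|->] := ltngtP (x : nat) y.
- by rewrite ltnS (ltnW xy) (ltn_eqF xy) (ltn_eqF (leqW xy)).
- rewrite ltnS leqNgt yx /=.
  have [h|h|h] := ltngtP (x : nat) (y + size ks).+1.
  + by rewrite (gtn_eqF (leqW yx)) eqSS (gtn_eqF yx).
  + have yx' : (y.+1 < x)%N by apply: leq_ltn_trans h; rewrite ltnS leq_addr.
    by rewrite (gtn_eqF yx) (gtn_eqF yx').
  + by rewrite (gtn_eqF (leqnn _)) eqxx.
- by rewrite leqnn eqxx ltnS leq_addr.
Qed.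

(** The cycle chi_{n,1} lowers the last point by n, so its words have at least n
    letters, and by [word_perm_descent] there is only one with n letters. *)
Lemma reduced_word_chi1 (n : nat) :
  map val (reduced_word (chi (addn1 n))) = iota 0 n.
Proof.
set c := chi (addn1 n).
have [redw redmin] := reduced_wordP c.
have enumw : word_perm (enum 'I_n) = c.
  apply/permP => x; apply: val_inj; rewrite /= (word_perm_iota (y := 0)).
    rewrite size_enum_ord chiE ltn0 add0n add1n.
    case: ltngtP => // [nx|->]; last by rewrite subnn.
    by have := ltn_ord x; rewrite ltnS leqNgt nx.
  by rewrite size_enum_ord val_enum_ord.
have szw : (size (reduced_word c) <= n)%N.
  by have := redmin _ enumw; rewrite size_enum_ord.
have [le_n eq_n] := word_perm_descent (reduced_word c) ord_max.
have c0 : c ord_max = 0%N :> nat by rewrite chiE ltnn subnn.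
rewrite redw c0 add0n /= in le_n eq_n.
have sz : n = size (reduced_word c) by apply/eqP; rewrite eqn_leq le_n szw.
by rewrite eq_n // -sz.
Qed.

(** * Recursion for beta_{n,1} *)

Section Beta.
Variables (K : fieldType) (A : lmodType K) (sigma : {linear A ⊗ A -> A ⊗ A}).

Lemma beta1E (n : nat) (z : tpow A n ⊗ A) :
  beta1 sigma n z
  = foldr (fun k y => sigma_at sigma n.+1 k y) (tsnoc A n z) (iota 0 n).
Proof.
rewrite /beta1 /= /beta /T_sigma -reduced_word_chi1.
by elim: (reduced_word _) => //= k ks ->.
Qed.

Lemma beta1_0 (c : K^o) (b : A) :
  beta1 sigma 0 (c ⊗t b : tpow A 0 ⊗ A) = c *: (b ⊗t (1 : K^o)).
Proof. by rewrite beta1E /= tunitlE linearZ. Qed.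

(** The reduced word 0, ..., n of chi_{n+1,1} is the letter 0 followed by the word
    of chi_{n,1} with all letters raised by one, and raising a letter by one
    tensors its action with the identity on the left. *)
Lemma beta1S (n : nat) (a : A) (u : tpow A n) (b : A) :
  beta1 sigma n.+1 ((a ⊗t u : tpow A n.+1) ⊗t b)
  = act12 (tpow A n) sigma (a ⊗t beta1 sigma n (u ⊗t b)).
Proof.
rewrite !beta1E [iota 0 n.+1]/= -[1%N]addn0 iotaDl /= foldr_map.
rewrite tassocE tmapE /=; congr (act12 _ _ _).
by elim: (iota 0 n) => //= k ks ->; rewrite tmapE.
Qed.

End Beta.

(** * Naturality of a braiding acting on the first two factors *)

Lemma act12_pure (K : fieldType) (V X : lmodType K) (phi : {linear V ⊗ V -> V ⊗ V})
    (a b : V) (x : X) :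
  act12 X phi (a ⊗t (b ⊗t x)) = tassoc (phi (a ⊗t b) ⊗t x).
Proof. by rewrite /act12 /= tassocVE tmapE. Qed.

Lemma act12_natural (K : fieldType) (V W X Y : lmodType K)
    (phi : {linear V ⊗ V -> V ⊗ V})
    (psi : {linear W ⊗ W -> W ⊗ W}) (f : {linear V -> W}) (g : {linear X -> Y}) :
    (forall x, (f ⊗m f) (phi x) = psi ((f ⊗m f) x)) ->
  forall z : V ⊗ (V ⊗ X),
  (f ⊗m (f ⊗m g)) (act12 X phi z) = act12 Y psi ((f ⊗m (f ⊗m g)) z).
Proof.
move=> f_phi z.
have assoc_nat (y : V ⊗ V) (x : X) :
    (f ⊗m (f ⊗m g)) (tassoc (y ⊗t x)) = tassoc ((f ⊗m f) y ⊗t g x).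
  apply: (@tensor_lin_eq _ _ _ _ ((f ⊗m (f ⊗m g)) \o tassoc \o tpurer _ x)
           (tassoc \o tpurer _ (g x) \o (f ⊗m f))) => b c /=.
  by rewrite /tpurer_fun tassocE !tmapE tassocE.
have pure_nat (a b : V) (x : X) :
    (f ⊗m (f ⊗m g)) (act12 X phi (a ⊗t (b ⊗t x)))
    = act12 Y psi ((f ⊗m (f ⊗m g)) (a ⊗t (b ⊗t x))).
  by rewrite act12_pure assoc_nat f_phi !tmapE act12_pure.
apply: (@tensor_lin_eq _ _ _ _ ((f ⊗m (f ⊗m g)) \o act12 X phi)
         (act12 Y psi \o (f ⊗m (f ⊗m g)))) => a y.
apply: (@tensor_lin_eq _ _ _ _
         ((f ⊗m (f ⊗m g)) \o act12 X phi \o tpurel _ a)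
         (act12 Y psi \o (f ⊗m (f ⊗m g)) \o tpurel _ a)) => b x.
exact: pure_nat.
Qed.

(** * The induced map on words *)

Lemma tmap_eqr (K : fieldType) (V W X Y : lmodType K) (f : {linear V -> X})
    (g h : {linear W -> Y}) :
  g =1 h -> f ⊗m g =1 f ⊗m h.
Proof. by move=> gh; apply: tensor_lin_eq => v w; rewrite !tmapE gh. Qed.

Section RotaBaxterExtension.
Variables (K : fieldType) (A R : lmodType K).
Variables (mA : {linear A ⊗ A -> A}) (sigma : {linear A ⊗ A -> A ⊗ A}).
Variables (mR : {linear R ⊗ R -> R}) (sigmaR : {linear R ⊗ R -> R ⊗ R}).
Variables (oneR : R) (P : {linear R -> R}) (f : {linear A -> R}).
Hypothesis unitR : unit_element mR oneR.

Local Notation F := (fbar_hom mR oneR P f).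
Local Notation Fbar := (fbar mR oneR P f).
Local Notation "x ∗ y" := (mR (x ⊗t y)) (at level 40, left associativity).

Lemma mul_scal_unit (c : K) (x : R) : x ∗ scal_unit_fun oneR c = c *: x.
Proof.
by rewrite /scal_unit_fun linearZr_LR linearZ /=; have [_ ->] := unitR x.
Qed.

Lemma scal_unit_mul (c : K) (x : R) : scal_unit_fun oneR c ∗ x = c *: x.
Proof.
by rewrite /scal_unit_fun linearZl_LR linearZ /=; have [-> _] := unitR x.
Qed.

(** The definition of F treats words of length one separately; the unit of R
    makes both cases the same formula, so that later inductions have a single
    step. *)
Lemma fbar_homS (n : nat) (a : A) (u : tpow A n) :
  F n.+1 (a ⊗t u : tpow A n.+1) = P (f a ∗ F n u).
Proof.
case: n u => [|n] u; last by rewrite /= tmapE.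
by rewrite /= tunitrE mul_scal_unit !linearZ.
Qed.

Lemma fbar_tcons (a : A) (x : tensor_alg A) :
  Fbar (tcons A (a ⊗t x)) = P (f a ∗ Fbar x).
Proof.
apply: (@dsum_lin_eq _ _ _ (Fbar \o tcons A \o tpurel _ a)
         (P \o mR \o tpurel _ (f a) \o Fbar)) => n u /=.
have -> : tcons A (tpurel_fun a (dinj_def (V := tpow A) u))
          = dinj n.+1 (a ⊗t u : tpow A n.+1).
  rewrite /tcons tliftE; apply: dsum_eq => -[|p] /=; first by rewrite dinj_neq.
  case: (eqVneq n p) => [<-|np]; first by rewrite !dinj_eq.
  by rewrite !dinj_neq ?eqSS // linear0r.
rewrite /tpurel_fun [LHS](dliftE F) fbar_homS.
by congr (P (mR (_ ⊗t _))); rewrite [RHS](dliftE F).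
Qed.

Lemma fbar_tcons_map (X : lmodType K) (g : {linear X -> tensor_alg A})
    (y : A ⊗ X) :
  Fbar (tcons A ((@idfun A ⊗m g) y)) = P (mR ((f ⊗m (Fbar \o g)) y)).
Proof.
apply: (@tensor_lin_eq _ _ _ _ (Fbar \o tcons A \o (@idfun A ⊗m g))
         (P \o mR \o (f ⊗m (Fbar \o g)))) => c x /=.
by rewrite !tmapE fbar_tcons.
Qed.

(** * Moving a letter across a word *)

Section Braided.
Hypothesis braidedR : braided_algebra mR sigmaR.
Hypothesis weakR : forall x : R ⊗ R,
  sigmaR ((P ⊗m @idfun R) x) = (@idfun R ⊗m P) (sigmaR x).
Hypothesis commR : braided_commutative mR sigmaR.
Hypothesis f_braided :
  forall x : A ⊗ A, (f ⊗m f) (sigma x) = sigmaR ((f ⊗m f) x).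

(** Here sigma' (P ⊗ id) = (id ⊗ P) sigma' extracts the outer P of F (a ⊗ u), and
    the compatibility of sigma' with the product of R then lets f b pass F u, by
    induction, and f a, by the hypothesis on f. *)
Lemma fbar_beta1 (n : nat) (u : tpow A n.+1) (b : A) :
  (f ⊗m F n.+1) (beta1 sigma n.+1 (u ⊗t b)) = sigmaR (F n.+1 u ⊗t f b).
Proof.
elim: n u => [|n ih] u.
  have pure1 (a : A) (c : K^o) :
      (f ⊗m F 1) (beta1 sigma 1 ((a ⊗t c : tpow A 1) ⊗t b))
      = sigmaR (F 1 (a ⊗t c : tpow A 1) ⊗t f b).
    rewrite beta1S beta1_0 linearZr_LR 2!linearZ act12_pure.
    have degree1 (z : A ⊗ A) : (f ⊗m F 1) (tassoc (z ⊗t (1 : K^o)))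
        = (@idfun R ⊗m P) ((f ⊗m f) z).
      apply: (@tensor_lin_eq _ _ _ _
               ((f ⊗m F 1) \o tassoc \o tpurer _ (1 : K^o))
               ((@idfun R ⊗m P) \o (f ⊗m f))) => a' b'.
      rewrite [LHS]/= /tpurer_fun tassocE [RHS]/= !tmapE /=.
      by rewrite tunitrE scale1r.
    rewrite degree1 f_braided tmapE -weakR tmapE.
    have -> : F 1 (a ⊗t c : tpow A 1) = c *: P (f a).
      by rewrite /= tunitrE !linearZ.
    by rewrite linearZl_LR linearZ.
  apply: (@tensor_lin_eq _ _ _ _
           ((f ⊗m F 1) \o beta1 sigma 1 \o tpurer _ b)
           (sigmaR \o tpurer _ (f b) \o F 1)) => a c.
  exact: pure1.
(* G is F in degree n.+2, in the form of a composite. *)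
pose G : {linear A ⊗ tpow A n.+1 -> R} := P \o mR \o (f ⊗m F n.+1).
have step (z : A ⊗ (A ⊗ tpow A n.+1)) :
      (f ⊗m G) (act12 _ sigma z)
      = (@idfun R ⊗m P) ((@idfun R ⊗m mR)
        (act12 R sigmaR ((f ⊗m (f ⊗m F n.+1)) z))).
  rewrite -(act12_natural (F n.+1) f_braided).
  apply: (@tensor_lin_eq _ _ _ _ (f ⊗m G)
           ((@idfun R ⊗m P) \o (@idfun R ⊗m mR)
            \o (f ⊗m (f ⊗m F n.+1)))) => a y /=.
  by rewrite !tmapE.
have pureS (a : A) (v : tpow A n.+1) :
    (f ⊗m F n.+2) (beta1 sigma n.+2 ((a ⊗t v : tpow A n.+2) ⊗t b))
    = sigmaR (F n.+2 (a ⊗t v : tpow A n.+2) ⊗t f b).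
  rewrite beta1S [LHS]step tmapE ih fbar_homS.
  have -> : P (f a ∗ F n.+1 v) ⊗t f b
    = (P ⊗m @idfun R) ((mR ⊗m @idfun R) (tassocV (f a ⊗t (F n.+1 v ⊗t f b)))).
    by rewrite tassocVE !tmapE.
  rewrite weakR -(braided_mull braidedR).
  by rewrite [in RHS]tmapE.
apply: (@tensor_lin_eq _ _ _ _
         ((f ⊗m F n.+2) \o beta1 sigma n.+2 \o tpurer _ b)
         (sigmaR \o tpurer _ (f b) \o F n.+2)) => a v.
exact: pureS.
Qed.

(** The empty word is covered by the unit law, the others by commutativity. *)
Lemma mul_fbar_beta1 (n : nat) (u : tpow A n) (b : A) :
  mR ((f ⊗m F n) (beta1 sigma n (u ⊗t b))) = F n u ∗ f b.
Proof.
case: n u => [|n] u; last by rewrite fbar_beta1 commR.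
by rewrite beta1_0 !linearZ tmapE /= mul_scal_unit scale1r scal_unit_mul.
Qed.

(** * Comparison with the quantum quasi-shuffle product *)

Hypothesis f_alg : algebra_map mA mR f.
Hypothesis RB : Rota_Baxter 1 mR P.

Lemma mul_fbar_beta1_id (i j : nat) (u : tpow A i) (b : A) (v : tpow A j) :
  mR ((f ⊗m (mR \o (F i ⊗m F j)))
    (beta1_id sigma i j (u ⊗t (b ⊗t v : tpow A j.+1))))
  = F i u ∗ f b ∗ F j v.
Proof.
rewrite /beta1_id /= tassocVE tmapE /= -mul_fbar_beta1.
apply: (@tensor_lin_eq _ _ _ _
          (mR \o (f ⊗m (mR \o (F i ⊗m F j))) \o tassoc \o tpurer _ v)
          (mR \o tpurer _ (F j v) \o mR \o (f ⊗m F i))) => c w /=.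
by rewrite /tpurer_fun tassocE !tmapE /= tmapE (braided_assoc braidedR).
Qed.

Lemma qsh_homSS (i j : nat) (a b : A) (u : tpow A i) (v : tpow A j) :
  let au : tpow A i.+1 := a ⊗t u in let bv : tpow A j.+1 := b ⊗t v in
  qsh_hom mA sigma i.+1 j.+1 (au ⊗t bv)
  = tcons A (a ⊗t qsh_hom mA sigma i j.+1 (u ⊗t bv))
  + tcons A ((@idfun A ⊗m qsh_hom mA sigma i.+1 j)
       (beta1_id sigma i.+1 j (au ⊗t bv)))
  + tcons A ((mA ⊗m qsh_hom mA sigma i j)
       (tassocV (a ⊗t beta1_id sigma i j (u ⊗t bv)))).
Proof.
move=> au bv.
have -> : qsh_hom mA sigma i.+1 j.+1 (au ⊗t bv)
  = tcons A ((@idfun A ⊗m qsh_hom mA sigma i j.+1) (tassoc (au ⊗t bv)))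
  + tcons A ((@idfun A ⊗m qsh_hom mA sigma i.+1 j)
       (beta1_id sigma i.+1 j (au ⊗t bv)))
  + tcons A ((mA ⊗m qsh_hom mA sigma i j) (tassocV
       ((@idfun A ⊗m beta1_id sigma i j) (tassoc (au ⊗t bv))))) by [].
by rewrite tassocE !tmapE.
Qed.

(** The Rota-Baxter identity of weight 1 on the right against the three terms of
    the product on the left. *)
Lemma fbar_qsh_hom (i j : nat) (u : tpow A i) (v : tpow A j) :
  Fbar (qsh_hom mA sigma i j (u ⊗t v)) = F i u ∗ F j v.
Proof.
elim: i j u v => [|i ihi] j u v.
  have -> : qsh_hom mA sigma 0 j (u ⊗t v) = dinj j (tunitl (u ⊗t v)) by [].
  by rewrite tunitlE [LHS](dliftE F) linearZ [RHS]scal_unit_mul.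
elim: j u v => [|j ihj] u v.
  have -> : qsh_hom mA sigma i.+1 0 (u ⊗t v) = dinj i.+1 (tunitr (u ⊗t v)).
    by [].
  by rewrite tunitrE [LHS](dliftE F) linearZ [RHS]mul_scal_unit.
have pure (a b : A) (u' : tpow A i) (v' : tpow A j) :
    Fbar (qsh_hom mA sigma i.+1 j.+1
      ((a ⊗t u' : tpow A i.+1) ⊗t (b ⊗t v' : tpow A j.+1)))
    = F i.+1 (a ⊗t u' : tpow A i.+1) ∗ F j.+1 (b ⊗t v' : tpow A j.+1).
  have ihrE : Fbar \o qsh_hom mA sigma i.+1 j =1 mR \o (F i.+1 ⊗m F j).
    apply: (@tensor_lin_eq _ _ _ _ (Fbar \o qsh_hom mA sigma i.+1 j)
             (mR \o (F i.+1 ⊗m F j))) => p q.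
    by rewrite [LHS]ihj /= tmapE.
  have ihE : Fbar \o qsh_hom mA sigma i j =1 mR \o (F i ⊗m F j).
    apply: (@tensor_lin_eq _ _ _ _ (Fbar \o qsh_hom mA sigma i j)
             (mR \o (F i ⊗m F j))) => p q.
    by rewrite [LHS]ihi /= tmapE.
  have second y :
      Fbar (tcons A ((@idfun A ⊗m qsh_hom mA sigma i.+1 j) y))
      = P (mR ((f ⊗m (mR \o (F i.+1 ⊗m F j))) y)).
    by rewrite fbar_tcons_map (tmap_eqr _ ihrE).
  (* Multiplying a into the first letter before or after applying f is the same,
     as f is multiplicative and R associative. *)
  have third y :
      Fbar (tcons A ((mA ⊗m qsh_hom mA sigma i j) (tassocV (a ⊗t y))))
      = P (f a ∗ mR ((f ⊗m (mR \o (F i ⊗m F j))) y)).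
    rewrite -(tmap_eqr _ ihE).
    apply: (@tensor_lin_eq _ _ _ _
             (Fbar \o tcons A \o (mA ⊗m qsh_hom mA sigma i j)
              \o tassocV \o tpurel _ a)
             (P \o mR \o tpurel _ (f a) \o mR
              \o (f ⊗m (Fbar \o qsh_hom mA sigma i j)))) => c x /=.
    rewrite /tpurel_fun tassocVE !tmapE fbar_tcons /= f_alg.
    by rewrite (braided_assoc braidedR).
  rewrite qsh_homSS 2!linearD fbar_tcons ihi second third.
  rewrite !mul_fbar_beta1_id !fbar_homS RB scale1r.
  by rewrite !(braided_assoc braidedR).
apply: (@tensor_lin_eq _ _ _ _
  (Fbar \o qsh_hom mA sigma i.+1 j.+1 \o tpurer _ v)
  (mR \o tpurer _ (F j.+1 v) \o F i.+1)) => a {}u.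
apply: (@tensor_lin_eq _ _ _ _
  (Fbar \o qsh_hom mA sigma i.+1 j.+1 \o tpurel _ (a ⊗t u))
  (mR \o tpurel _ (F i.+1 (a ⊗t u)) \o F j.+1)) => b {}v.
exact: pure.
Qed.

End Braided.

End RotaBaxterExtension.

Unset Implicit Arguments.

Theorem theorem7p3 (K : fieldType) (charK : [pchar K] =i pred0)
    (A : lmodType K) (mA : {linear A ⊗ A -> A})
    (sigma : {linear A ⊗ A -> A ⊗ A})
    (braidedA : braided_algebra mA sigma)
    (R : lmodType K) (mR : {linear R ⊗ R -> R})
    (sigmaR : {linear R ⊗ R -> R ⊗ R}) (P : {linear R -> R})
    (braidedR : right_weak_braided_RB 1 mR sigmaR P)
    (commR : braided_commutative mR sigmaR)
    (oneR : R) (unitR : unit_element mR oneR)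
    (f : {linear A -> R}) (f_alg : algebra_map mA mR f)
    (f_braided : forall x : A ⊗ A, (f ⊗m f) (sigma x) = sigmaR ((f ⊗m f) x)) :
  algebra_map (qsh mA sigma) mR (fbar mR oneR P f).
Proof.
case: braidedR => brR RB weakR x y; set F := fbar mR oneR P f.
apply: (@dsum_lin_eq _ _ _ (F \o qsh mA sigma \o tpurer _ y)
         (mR \o tpurer _ (F y) \o F)) => i u.
apply: (@dsum_lin_eq _ _ _ (F \o qsh mA sigma \o tpurel _ (dinj i u))
         (mR \o tpurel _ (F (dinj i u)) \o F)) => j v.
rewrite [LHS](congr1 F (dlift2E (qsh_hom mA sigma) u v)).
rewrite [LHS](fbar_qsh_hom unitR brR weakR commR f_braided f_alg RB).
by congr (mR (_ ⊗t _)); rewrite [RHS](dliftE (fbar_hom mR oneR P f)).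
Qed.
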